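(* Let $n\ge 1$ be an integer, let $q$ be a prime power, let $N=\frac{n(n-1)}{2}$, and let $H_0\subseteq H_1\subseteq\cdots\subseteq H_N=U_n(\mathbb{F}_q)$ be the nested sequence of pattern groups defined in the context. Suppose that $1\le m\le N$. Let $T_m$ be a random element of the group $H_m$ such that $$\mathbb{P}(T_m=g)=\frac{1}{k(H_m)}\cdot\frac{1}{|O_{H_m}(g)|},\qquad\text{for all }g\in H_m.$$ Define $K_m:H_m\to\mathbb{R}$ by $K_m(g)=0$ if $g\notin H_{m-1}$ and $K_m(g)=\frac{|C_{H_{m-1}}(g)|}{|C_{H_m}(g)|}$ if $g\in H_{m-1}$. Then $$q\,\mathbb{E}[K_m(T_m)]=\frac{k(H_{m-1})}{k(H_m)}.$$
   Context: $\mathbb{F}_q$ is the finite field with $q$ elements, and $U_n(\mathbb{F}_q)$ is the group of $n\times n$ upper triangular matrices over $\mathbb{F}_q$ with ones on the diagonal. A set $J\subseteq\{(i,j):1\le i<j\le n\}$ is closed if $(i,j)\in J$ and $(j,k)\in J$ imply $(i,k)\in J$. For closed $J$, the pattern group $U_J$ is the subgroup of all $(u_{ij})\in U_n(\mathbb{F}_q)$ with $u_{ij}=0$ for every $(i,j)$ such that $1\le i<j\le n$ and $(i,j)\notin J$. For $1\le i<j\le n$, let $J_{i,j}$ be the (closed) set of pairs $(k,l)$ with $1\le k<l\le n$ such that either $k>i$, or $k=i$ and $l\ge j$. Let $H_0$ be the trivial group consisting of the identity matrix, and for $1\le m\le N$ let $H_m=U_{J_{k_m,l_m}}$, where $(k_m,l_m)$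 is the unique pair with $1\le k_m<l_m\le n$ and $$\frac{(n-k_m)(n-k_m-1)}{2}+n-l_m+1=m.$$ (That is, the positions strictly above the diagonal are released one at a time, rows from bottom to top and within each row from right to left.) One has $|H_m|=q^m$ for $0\le m\le N$. For a finite group $G$, $k(G)$ denotes the number of conjugacy classes of $G$; for $g\in G$, $O_G(g)$ denotes the conjugacy class of $g$ in $G$, and $C_G(g)=\{z\in G: zg=gz\}$ denotes its centralizer in $G$. *)

(* Defs.v *)
From HB Require Import structures.
From mathcomp Require Import all_boot all_order all_algebra all_fingroup.
From mathcomp Require Import zify.

Set Implicit Arguments.
Unset Strict Implicit.
Unset Printing Implicit Defensive.

Import GRing.Theory.
Local Open Scope ring_scope.

(* The library type {'GL_n[F]} consists of the invertible matrices of size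
   n.-1.+1, which is n for n >= 1; hence the index type below. Matrix indices
   are counted from 0, so the mathematical position (k, l) is the pair of
   ordinals (k - 1, l - 1). *)
Notation mxindex n := 'I_n.-1.+1.
Notation position n := (mxindex n * mxindex n)%type.

Definition is_closed n (J : {set position n}) : Prop :=
  forall i j k : mxindex n, (i, j) \in J -> (j, k) \in J -> (i, k) \in J.

Definition unitriangular n (F : finFieldType) : {set {'GL_n[F]}} :=
  [set u : {'GL_n[F]} | [forall i : mxindex n, [forall j : mxindex n,
     (j <= i)%N ==> (GLval u i j == (i == j)%:R)]]].

Definition pattern_group n (F : finFieldType) (J : {set position n}) :
    {set {'GL_n[F]}} :=
  [set u in unitriangular n F | [forall i : mxindex n, [forall j : mxindex n,
     (i < j)%N && ((i, j) \notin J) ==> (GLval u i j == 0)]]].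

Lemma pattern_group_group_set n (F : finFieldType) (J : {set position n}) :
  is_closed J -> group_set (pattern_group F J).
Proof.
move=> clJ.
have memP (u : {'GL_n[F]}) : reflect
   ((forall i j : mxindex n, (j <= i)%N -> GLval u i j = (i == j)%:R) /\
    (forall i j : mxindex n, (i < j)%N -> (i, j) \notin J -> GLval u i j = 0))
   (u \in pattern_group F J).
  rewrite !inE; apply: (iffP andP) => [[/forallP U /forallP V]|[U V]]; split.
  - by move=> i j ij; have /forallP/(_ j)/implyP/(_ ij)/eqP := U i.
  - move=> i j ij nJ; have /forallP/(_ j) := V i.
    by rewrite ij nJ => /eqP.
  - by apply/forallP=> i; apply/forallP=> j; apply/implyP=> /U ->.
  - apply/forallP=> i; apply/forallP=> j; apply/implyP=> /andP[ij nJ].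
    by rewrite V.
apply/group_setP; split=> [|u v /memP[Ud Uz] /memP[Vd Vz]].
  apply/memP; split=> i j ij => [|_]; rewrite GL_1E mxE //.
  by rewrite -val_eqE ltn_eqF.
apply/memP; split=> i j ij.
  rewrite GL_ME mxE; have [<-|nij] := eqVneq i j.
    rewrite (bigD1 i) //= Ud // Vd // eqxx mulr1 big1 ?addr0 // => k ki.
    have [ik|ik] := leqP k i.
      by rewrite Ud // eq_sym (negPf ki) mul0r.
    by rewrite (Vd k i) ?(ltnW ik) // (negPf ki) mulr0.
  apply: big1 => k _; have [ki|ik] := leqP k i.
    have [e|ne] := eqVneq i k; last by rewrite Ud // (negPf ne) mul0r.
    by rewrite -e (Vd i j) // (negPf nij) mulr0.
  rewrite (Vd k j) ?(leq_trans ij) ?(ltnW ik) //.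
  by rewrite -val_eqE /= gtn_eqF ?mulr0 // (leq_ltn_trans ij).
move=> nJ; rewrite GL_ME mxE; apply: big1 => k _.
have nij : (i == j) = false by rewrite -val_eqE /= ltn_eqF.
have [ki|ik] := leqP k i.
  have [e|ne] := eqVneq i k; last by rewrite Ud // (negPf ne) mul0r.
  by rewrite -e (Vz i j) // mulr0.
have [jk|kj] := leqP j k.
  have [e|ne] := eqVneq k j; last by rewrite Vd // (negPf ne) mulr0.
  by rewrite e (Uz i j) // mul0r.
have [iJ|iJ] := boolP ((i, k) \in J); last by rewrite Uz // mul0r.
have [kJ|kJ] := boolP ((k, j) \in J); last by rewrite (Vz k j) // mulr0.
by rewrite (clJ _ _ _ iJ kJ) in nJ.
Qed.

Definition release_set n (p : position n) : {set position n} :=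
  [set r : position n | (r.1 < r.2)%N &&
     ((p.1 < r.1)%N || ((r.1 == p.1) && (p.2 <= r.2)%N))].

Lemma release_set_closed n (p : position n) : is_closed (release_set p).
Proof.
move=> i j k; rewrite !inE /= -!val_eqE /= => ij jk; lia.
Qed.

Definition release_rank n (p : position n) : nat :=
  let k := p.1.+1 in let l := p.2.+1 in
  (((n - k) * (n - k - 1)) %/ 2 + (n - l) + 1)%N.

Definition is_mth_position n (m : nat) (p : position n) : bool :=
  (p.1 < p.2)%N && (release_rank p == m).

(* For 1 <= m <= n (n - 1) / 2 the position picked here exists and is unique,
   see ex_mth_position and mth_position_uniq. *)
Definition release_group n (F : finFieldType) (m : nat) : {set {'GL_n[F]}} :=
  if m == 0%N then 1%g else
  if [pick p : position n | is_mth_position m p] is Some p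
  then pattern_group F (release_set p) else 1%g.

Lemma release_group_set n (F : finFieldType) m : group_set (release_group n F m).
Proof.
rewrite /release_group; case: (m == 0%N); first exact: group_set_one.
case: pickP => [p _|_]; last exact: group_set_one.
exact/pattern_group_group_set/release_set_closed.
Qed.

Canonical release_group_group n (F : finFieldType) m : {group {'GL_n[F]}} :=
  Group (release_group_set n F m).

Lemma divn2_succ a : ((a.+1 * a) %/ 2 = (a * (a - 1)) %/ 2 + a)%N.
Proof.
have -> : (a.+1 * a = a * (a - 1) + a * 2)%N by case: a => // a; nia.
by rewrite addnC divnMDl // addnC.
Qed.

Lemma ex_mth_position n m : (0 < n)%N ->
  (0 < m <= (n * (n - 1)) %/ 2)%N -> exists p : position n, is_mth_position m p.
Proof.
move=> n_gt0 /andP[m_gt0 m_le].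
suff [k [l [kl ln e]]] : exists k l : nat, [/\ (k < l)%N, (l < n)%N &
    (((n - k.+1) * (n - k.+1 - 1)) %/ 2 + (n - l.+1) + 1 = m)%N].
  have lt x : (x < n)%N -> (x < n.-1.+1)%N by lia.
  exists (Ordinal (lt _ (ltn_trans kl ln)), Ordinal (lt _ ln)).
  by rewrite /is_mth_position /release_rank /= kl e eqxx.
have : exists a, [&& a < n, (a * (a - 1)) %/ 2 < m & m <= (a.+1 * a) %/ 2]%N.
  elim: n n_gt0 m_le => [//|[|n] IH] _ m_le; first by lia.
  have [lt|ge] := ltnP ((n.+1 * (n.+1 - 1)) %/ 2)%N m.
    exists n.+1; rewrite ltnSn lt /=.
    by move: m_le; rewrite subn1.
  by have [a /and3P[an lo hi]] := IH isT ge; exists a; rewrite lo hi ltnW.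
case=> a /and3P[an lo]; rewrite divn2_succ => hi.
exists (n - a.+1)%N; exists (n + (a * (a - 1)) %/ 2 - m)%N.
have -> : (n - (n - a.+1).+1 = a)%N by lia.
by split; lia.
Qed.

Lemma mth_position_uniq n m (p r : position n) :
  (0 < n)%N -> is_mth_position m p -> is_mth_position m r -> p = r.
Proof.
case: p r => [k l] [k' l']; rewrite /is_mth_position /release_rank /=.
move=> n_gt0 /andP[kl /eqP e] /andP[kl' /eqP e'].
have mono a b : (a < b)%N ->
    ((a * (a - 1)) %/ 2 + a <= (b * (b - 1)) %/ 2)%N.
  move=> ab; rewrite -divn2_succ leq_div2r // leq_mul //; lia.
have [ln ln'] := (ltn_ord l, ltn_ord l').
have ek : k = k' :> nat.
  have := mono (n - k.+1)%N (n - k'.+1)%N.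
  have := mono (n - k'.+1)%N (n - k.+1)%N.
  lia.
by congr (_, _); apply: val_inj => //=; move: e e'; rewrite ek; lia.
Qed.

Definition class_number (gT : finGroupType) (G : {set gT}) : nat := #|classes G|.

Definition centralizer_ratio (R : numFieldType) n (F : finFieldType) (m : nat)
    (g : {'GL_n[F]}) : R :=
  if g \in release_group n F m.-1
  then #|'C_(release_group n F m.-1)[g]%g|%:R / #|'C_(release_group n F m)[g]%g|%:R
  else 0.

(* Main.v *)
(* By the orbit-stabilizer formula the centralizer in H_m cancels against the
   conjugacy class in the law of T_m, so the expectation is the sum of
   |C_{H_{m-1}}(g)| over g in H_{m-1}, divided by k(H_m) |H_m|. Burnside's
   lemma evaluates this sum as k(H_{m-1}) |H_{m-1}|, and |H_m| = q |H_{m-1}|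
   because H_m has exactly one more free matrix entry. *)
Require Import Defs.
From HB Require Import structures.
From mathcomp Require Import all_boot all_order all_algebra all_fingroup.
From mathcomp Require Import all_classical all_reals all_analysis measurable_realfun.
From mathcomp Require Import zify ring.

Set Implicit Arguments.
Unset Strict Implicit.
Unset Printing Implicit Defensive.

Import GRing.Theory Num.Theory.

(** Burnside's lemma for the action of [G] on itself by conjugation: the points fixed by [g] form
    its centralizer and the orbits are the conjugacy classes. *)
Lemma sum_card_cent1 (gT : finGroupType) (G : {group gT}) :
  (\sum_(g in G) #|'C_G[g]%g| = class_number G * #|G|)%N.
Proof.
have actsG : [acts G, on G | conjg_action gT]%g by rewrite astabsJ normG.
rewrite /class_number -(Frobenius_Cauchy actsG).
apply: eq_bigr => g _; apply: eq_card => x.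
rewrite !finset.in_setI; congr andb.
by apply/cent1P/afix1P => [/commgP/conjg_fixP | /conjg_fixP/commgP].
Qed.

Lemma pattern_groupP n (F : finFieldType) (J : {set position n})
    (u : {'GL_n[F]}) :
  reflect ((forall i j : mxindex n, (j <= i)%N -> GLval u i j = (i == j)%:R%R) /\
     (forall i j : mxindex n, (i < j)%N -> (i, j) \notin J -> GLval u i j = 0%R))
    (u \in pattern_group F J).
Proof.
rewrite !inE.
apply: (iffP andP) => [[/forallP lowu /forallP upu] | [lowu upu]]; split.
- by move=> i j ij; have /forallP/(_ j)/implyP/(_ ij)/eqP := lowu i.
- by move=> i j ij nJ; have /forallP/(_ j) := upu i; rewrite ij nJ => /eqP.
- by do 2![apply/forallP=> ?]; apply/implyP=> /lowu ->.
- by do 2![apply/forallP=> ?]; apply/implyP=> /andP[ij nJ]; rewrite upu.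
Qed.

Lemma pattern_groupS n (F : finFieldType) (J K : {set position n}) :
  J \subset K -> pattern_group F J \subset pattern_group F K.
Proof.
move=> /fintype.subsetP JK; apply/fintype.subsetP=> u /pattern_groupP[lowu upu].
apply/pattern_groupP; split=> // i j ij nK.
by apply: upu => //; apply: contra nK => /JK.
Qed.

(** The entries at positions of [J] are free and all others are forced, so functions supported in
    [J] parametrize the matrices. As [J] lies above the diagonal, each such filling [A f] is
    unitriangular, hence invertible. *)
Lemma card_pattern_group n (F : finFieldType) (J : {set position n}) :
  (forall r, r \in J -> (r.1 < r.2)%N) -> #|pattern_group F J| = (#|F| ^ #|J|)%N.
Proof.
move=> upJ; have upJf (i j : mxindex n) : (j <= i)%N -> ((i, j) \in J) = false.
  by move=> ji; apply/negP => /upJ; rewrite ltnNge ji.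
pose A (f : {ffun position n -> F}) : 'M[F]_(n.-1.+1) :=
  (\matrix_(i, j) if (i, j) \in J then f (i, j) else (i == j)%:R)%R.
have unitA f : A f \in unitmx.
  (* [det_trig] concerns lower triangular matrices, whence the transpose. *)
  rewrite unitmxE -det_tr det_trig; last first.
    apply/is_trig_mxP => i j ij; rewrite !mxE upJf 1?ltnW //.
    by rewrite -val_eqE gtn_eqF.
  by rewrite big1 ?unitr1 // => i _; rewrite !mxE upJf // eqxx.
pose g f : {'GL_n[F]} := FinRing.Unit (unitA f).
have gE f : GLval (g f) = A f by [].
rewrite -(card_pffun_on (0%R : F) J predT) -(@card_in_imset _ _ g).
  apply: eq_card => u; apply/pattern_groupP/imsetP => [[lowu upu] | [f _ ->]].
    exists [ffun r => if r \in J then GLval u r.1 r.2 else 0%R].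
      apply/pffun_onP; split; last by [].
      by apply/fintype.subsetP => r; rewrite inE ffunE; case: ifP => //; rewrite eqxx.
    apply/val_inj/matrixP => i j; rewrite -[val (g _)]/(GLval (g _)) gE mxE ffunE /=.
    rewrite -[val u]/(GLval u); have [// | nJ] := boolP ((i, j) \in J).
    have [ji | ij] := leqP j i; first by rewrite lowu.
    by rewrite upu // -val_eqE ltn_eqF.
  split=> i j ij => [|/negPf nJ]; rewrite gE mxE; first by rewrite upJf.
  by rewrite nJ -val_eqE ltn_eqF.
move=> f1 f2 /pffun_onP[/fintype.subsetP s1 _] /pffun_onP[/fintype.subsetP s2 _] eg.
have eA : A f1 = A f2 by rewrite -!gE eg.
apply/ffunP => -[i j]; have [iJ | nJ] := boolP ((i, j) \in J).
  by have /matrixP/(_ i j) := eA; rewrite !mxE iJ.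
(* Off [J] the matrices carry no information on [f1] and [f2], but there both functions vanish. *)
have/= f0 (f : {ffun position n -> F}) :
    {subset 0%R.-support f <= J} -> f (i, j) = 0%R.
  by move=> s; apply/eqP; apply: contraNT nJ => /= nz; apply: s.
by rewrite !f0.
Qed.

(** A description of the positions of [H_m] that involves no choice and covers m = 0, so that
    consecutive groups can be compared directly. *)
Definition released n m : {set position n} :=
  [set r : position n | (r.1 < r.2)%N && (release_rank r <= m)%N].

Lemma release_rank_gt0 n (r : position n) : (0 < release_rank r)%N.
Proof. by rewrite /release_rank addn1. Qed.

(** A row with a positions above the diagonal occupies the ranks from a(a-1)/2 + 1 to a(a-1)/2 + a,
    decreasing from left to right. Thus the rank enumerates positions in their order of release. *)
Lemma release_set_rank n (p r : position n) : (0 < n)%N ->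
  (p.1 < p.2)%N -> (r.1 < r.2)%N ->
  (r \in release_set p) = (release_rank r <= release_rank p)%N.
Proof.
case: p r => [i j] [k l] n_gt0 /= ij kl; rewrite inE /= kl /release_rank /=.
(* The block of ranks of a shorter row ends before that of a longer row begins. *)
have mono a b : (a < b)%N -> ((a * (a - 1)) %/ 2 + a <= (b * (b - 1)) %/ 2)%N.
  by move=> ab; rewrite -divn2_succ leq_div2r // leq_mul //; lia.
have [jn ln] := (ltn_ord j, ltn_ord l).
have := mono (n - i.+1)%N (n - k.+1)%N; have := mono (n - k.+1)%N (n - i.+1)%N.
rewrite -val_eqE /=; have [-> | ne] := eqVneq (i : nat) k; lia.
Qed.

Lemma release_groupE n (F : finFieldType) m : (0 < n)%N ->
  (m <= (n * (n - 1)) %/ 2)%N ->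
  release_group n F m = pattern_group F (released n m).
Proof.
move=> n_gt0 m_le; rewrite /release_group; case: eqP => [-> | /eqP m_neq0].
  (* For m = 0 no position is released, since ranks are positive; the pattern group contains the
     identity and has order [#|F| ^ 0]. *)
  apply/eqP; rewrite eqEcard; apply/andP; split.
    apply/fintype.subsetP=> u /set1gP->; apply/pattern_groupP.
    split=> i j ij; rewrite GL_1E mxE //.
    by rewrite -val_eqE ltn_eqF.
  rewrite card_pattern_group => [|r]; last by rewrite inE => /andP[].
  rewrite cards1 (_ : released n 0 = finset.set0) ?cards0 //.
  by apply/finset.setP => r; rewrite !inE
    [(release_rank r <= 0)%N]leqNgt release_rank_gt0 andbF.
case: pickP => [p /andP[up /eqP pm] | nop].
  congr (pattern_group F _); apply/finset.setP => r; rewrite [RHS]inE -pm.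
  have [ur | nur] := boolP (r.1 < r.2)%N; first exact: release_set_rank.
  by rewrite inE (negPf nur).
have [|p] := @ex_mth_position n m n_gt0; first by rewrite lt0n m_neq0.
by rewrite nop.
Qed.

Lemma card_release_group n (F : finFieldType) m : (0 < n)%N ->
  (0 < m <= (n * (n - 1)) %/ 2)%N ->
  #|release_group n F m| = (#|F| * #|release_group n F m.-1|)%N.
Proof.
move=> n_gt0 /[dup] m_in /andP[m_gt0 m_le].
rewrite !release_groupE //; last exact: leq_trans (leq_pred m) m_le.
rewrite !card_pattern_group => [|r|r]; try by rewrite inE => /andP[].
have [p mp] := ex_mth_position n_gt0 m_in; have /andP[up /eqP pm] := mp.
(* Removing [p], the only position of rank [m], from [released n m] leaves [released n m.-1]. *)
rewrite -expnS (cardsD1 p (released n m)) inE up pm leqnn.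
congr (_ ^ _.+1)%N; apply: eq_card => r; rewrite !inE.
have [-> | rp] := eqVneq r p; first by rewrite pm; lia.
have [ur | //] := boolP (r.1 < r.2)%N.
have [rm | ] := eqVneq (release_rank r) m; last by lia.
by rewrite (@mth_position_uniq n m r p) ?eqxx // /is_mth_position ur rm eqxx in rp.
Qed.

Lemma release_group_predS n (F : finFieldType) m : (0 < n)%N ->
  (m <= (n * (n - 1)) %/ 2)%N ->
  release_group n F m.-1 \subset release_group n F m.
Proof.
move=> n_gt0 m_le; have m1_le := leq_trans (leq_pred m) m_le.
rewrite !release_groupE //; apply/pattern_groupS/fintype.subsetP => r.
by rewrite !inE => /andP[-> /leq_trans->] //; apply: leq_pred.
Qed.

(** The variable [f \o T] is a finite combination of indicators of the fibres of [T]. Nonnegativity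
    lets the integral pass through the sum without an integrability argument. *)
Lemma expectation_finite (R : realType) (d : measure_display)
    (Omega : measurableType d) (P : probability Omega R) (I : finType)
    (A : {set I}) (T : Omega -> I) (f : I -> R) :
  (forall w, T w \in A) ->
  (forall i, i \in A -> measurable (T @^-1` [set i])%classic) ->
  (forall i, 0 <= f i)%R ->
  ('E_P[f \o T] = \sum_(i in A) (f i)%:E * P (T @^-1` [set i])%classic)%E.
Proof.
move=> TA mT f_ge0; rewrite unlock.
have mT' i : measurable (T @^-1` [set i])%classic.
  (* Fibres over points outside [A] are empty. *)
  have [/mT // | iA] := boolP (i \in A).
  rewrite (_ : _ @^-1` _ = classical_sets.set0)%classic; first exact: measurable0.
  by rewrite -subset0 => w /= Tw; rewrite -Tw TA in iA.
pose h i w : \bar R := ((f i)%:E * (\1_(T @^-1` [set i])%classic w)%:E)%E.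
(* At [w] only the summand with [i = T w] survives. *)
have -> : (fun w => ((f \o T) w)%:E) = (fun w => \sum_(i <- enum A) h i w)%E.
  apply/funext => w; rewrite big_enum (bigD1 (T w)) //= big1 ?adde0; last first.
    move=> i /andP[_ iT]; rewrite /h indicE memNset ?mule0 //.
    by move=> e; rewrite e eqxx in iT.
  by rewrite /h indicE mem_set // mule1.
have mind i : measurable_fun classical_sets.setT
    (\1_(T @^-1` [set i])%classic : Omega -> R)%R.
  exact/measurable_indicP.
rewrite ge0_integral_sum //= => [|i|i w _].
- rewrite big_enum; apply: eq_bigr => i iA.
  rewrite ge0_integralZl_EFin //; last exact/measurable_EFinP/mind.
  by rewrite integral_indic // setIT.
- exact/measurable_funeM/measurable_EFinP/mind.
- by rewrite /h mule_ge0 // lee_fin.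
Qed.

Theorem proposition4p1 (n q m : nat) (n_gt0 : (1 <= n)%N)
    (F : finFieldType) (card_F : #|F| = q)
    (m_gt0 : (1 <= m)%N) (m_leN : (m <= (n * (n - 1)) %/ 2)%N)
    (R : realType) (d : measure_display) (Omega : measurableType d)
    (P : probability Omega R) (T : Omega -> {'GL_n[F]})
    (T_in : forall w : Omega, T w \in release_group n F m)
    (T_meas : forall g : {'GL_n[F]}, g \in release_group n F m ->
       measurable (T @^-1` [set g])%classic)
    (T_law : forall g : {'GL_n[F]}, g \in release_group n F m ->
       P (T @^-1` [set g])%classic =
         ((class_number (release_group n F m))%:R^-1 *
          #|(g ^: release_group n F m)%g|%:R^-1)%R%:E) :
  (q%:R%:E * 'E_P[fun w => centralizer_ratio R m (T w)] =
   ((class_number (release_group n F m.-1))%:R /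
    (class_number (release_group n F m))%:R)%R%:E)%E.
Proof.
pose H := release_group_group n F m; pose K := release_group_group n F m.-1.
have m_in : (0 < m <= (n * (n - 1)) %/ 2)%N by rewrite m_gt0.
have cardH : #|H| = (q * #|K|)%N by rewrite -card_F; apply: card_release_group.
have neq0 (G : {group {'GL_n[F]}}) : (#|G|%:R != 0 :> R)%R.
  by rewrite pnatr_eq0 -lt0n cardG_gt0.
have q_neq0 : (q%:R != 0 :> R)%R.
  by apply: contraNneq (neq0 H) => q0; rewrite cardH natrM q0 mul0r.
have KH : K \subset H by apply: release_group_predS.
rewrite -[X in 'E_P[X]%E]/(centralizer_ratio R m \o T).
rewrite (expectation_finite P T_in T_meas); last first.
  by move=> g; rewrite /centralizer_ratio; case: ifP; rewrite // divr_ge0 // ler0n.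
have termE g : g \in H ->
    ((centralizer_ratio R m g)%:E * P (T @^-1` [set g])%classic =
     ((if g \in K then #|'C_K[g]%g| else 0%N)%:R
        / ((class_number H)%:R * #|H|%:R))%R%:E)%E.
  (* Orbit-stabilizer makes the denominator of each term independent of [g]; for [g] outside [K]
     both sides are zero. *)
  have -> : #|H| = (#|'C_H[g]%g| * #|(g ^: H)%g|)%N.
    by rewrite -index_cent1 Lagrange // subsetIl.
  move=> gH; rewrite T_law // -EFinM natrM; congr EFin.
  rewrite /centralizer_ratio -[release_group n F m]/(H : {set _}).
  by case: ifP => _; [rewrite !invfM; ring | rewrite !mul0r].
rewrite (eq_bigr _ termE) sumEFin -EFinM; congr EFin.
(* The zero values outside [K] restrict the sum over [H] to [K]. *)
rewrite -mulr_suml -natr_sum -big_mkcondr /=.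
rewrite (eq_bigl (mem K)); last first.
  by move=> g /=; rewrite andb_idl // => /(fintype.subsetP KH).
(* The factor [q] in front cancels against the one in [#|H|], and [#|K|] against the one from
   Burnside's lemma. *)
rewrite sum_card_cent1 cardH !natrM; field.
by rewrite neq0 q_neq0 pnatr_eq0 -lt0n (classes_gt0 H).
Qed.
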